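(* Let $K\ge 2$ be an integer and let $\mathcal{J}$ be a nonempty set of nonempty compact subintervals of $[0,1]$. Then $$\dim_H E_{\sigma_K}(\mathcal{J})=\dim_H D_{\sigma_K}(\mathcal{J})=2-\inf\{\sup I: I\in\mathcal{J}\}.$$
   Context: $\Sigma_K=\{0,\dots,K-1\}^{\mathbb{N}}$ with $\mathbb{N}=\{0,1,2,\dots\}$, endowed with the metric $\rho(x,y)=K^{-\delta(x,y)}$, where $\delta(x,y)=\inf\{i\ge 0:x_i\ne y_i\}$ ($\rho(x,x)=0$). The shift map $\sigma_K:\Sigma_K\to\Sigma_K$ is $(\sigma_K(x))_i=x_{i+1}$. The product $\Sigma_K\times\Sigma_K$ carries the sup metric. For a continuous surjective self-map $f$ of a compact metric space $(X,\rho)$, for $x,y\in X$ and $\epsilon>0$, put $$F_{x,y}(\epsilon)=\liminf_{n\to\infty}\tfrac1n\#\{0\le i<n:\rho(f^i(x),f^i(y))<\epsilon\},\quad F^*_{x,y}(\epsilon)=\limsup_{n\to\infty}\tfrac1n\#\{0\le i<n:\rho(f^i(x),f^i(y))<\epsilon\}.$$ For $0\le p\le q\le1$ (the case $p=q$ is allowed), $$E_f([p,q])=\{(x,y)\in X\times X:\lim_{\epsilon\to0^+}F^*_{x,y}(\epsilon)=q,\ \lim_{\epsilon\to0^+}F_{x,y}(\epsilon)=p\},$$ $$D_f([p,q])=\{(x,y)\in X\times X:\text{there is }\epsilon_0>0\text{ with }F^*_{x,y}(\epsilon)=q\text{ and }F_{x,y}(\epsilon)=p\text{ for all }\epsilon\in(0,\epsilon_0]\}.$$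 For a set $\mathcal{J}$ of nonempty compact subintervals of $[0,1]$, $E_f(\mathcal{J})=\bigcup_{I\in\mathcal{J}}E_f(I)$ and $D_f(\mathcal{J})=\bigcup_{I\in\mathcal{J}}D_f(I)$. $\dim_H$ is Hausdorff dimension. *)

(* Defs.v *)
From HB Require Import structures.
From mathcomp Require Import all_boot all_order all_algebra.
From mathcomp Require Import all_classical all_reals all_analysis.

Set Implicit Arguments.
Unset Strict Implicit.
Unset Printing Implicit Defensive.

Import Order.TTheory GRing.Theory Num.Theory.
Import numFieldNormedType.Exports.

Local Open Scope classical_set_scope.
Local Open Scope ring_scope.

(* The library equips products with the pseudometric whose balls are products
   of balls; the corresponding distance is the sup (max) distance. *)
Section product_metric.
Context {R : realFieldType} {T U : metricType R}.

Definition prod_mdist (x y : T * U) : R :=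
  Num.max (mdist x.1 y.1) (mdist x.2 y.2).

Let prod_mdist_ge0 x y : 0 <= prod_mdist x y.
Proof. by rewrite le_max mdist_ge0. Qed.

Let prod_mdist_positivity x y : prod_mdist x y = 0 -> x = y.
Proof.
case: x y => [x1 x2] [y1 y2] /eqP; rewrite eq_le => /andP[+ _].
rewrite ge_max /= => /andP[h1 h2].
congr pair; apply: (@mdist_positivity R); apply/eqP;
  by rewrite eq_le mdist_ge0 ?h1 ?h2.
Qed.

Let prod_ballEmdist x d : ball x d = [set y | prod_mdist x y < d].
Proof.
case: x => x1 x2; apply/seteqP; split => -[y1 y2] /=;
  rewrite /prod_mdist /= gt_max.
- by case; rewrite /= !ballEmdist /= => -> ->.
- by case/andP => h1 h2; split; rewrite /= ballEmdist.
Qed.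

HB.instance Definition _ := PseudoMetric_isMetric.Build R (T * U)%type
  prod_mdist_ge0 prod_mdist_positivity prod_ballEmdist.

End product_metric.

Section hausdorff_dimension.
Context {R : realType} {T : metricType R}.
Local Open Scope ereal_scope.

(* The element 0 only matters for the empty set, whose diameter is thus 0. *)
Definition diam (A : set T) : \bar R :=
  ereal_sup (0 |` [set (mdist z.1 z.2)%:E | z in A `*` A]).

(* Since 0 `^ 0 = 1, the empty set is singled out so that it always
   contributes 0, including for s = 0. *)
Definition diam_pow (s : R) (A : set T) : \bar R :=
  if A == set0 then 0 else diam A `^ s.

Definition countable_covers (delta : R) (A : set T) : set (nat -> set T) :=
  [set U | A `<=` \bigcup_i U i /\ forall i, diam (U i) <= delta%:E].

Definition hausdorff_premeasure (s delta : R) (A : set T) : \bar R :=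
  ereal_inf [set \sum_(0 <= i <oo) diam_pow s (U i)
            | U in countable_covers delta A].

Definition hausdorff_measure (s : R) (A : set T) : \bar R :=
  ereal_sup [set hausdorff_premeasure s delta A
            | delta in [set delta : R | (0 < delta)%R]].

Definition hausdorff_dim (A : set T) : \bar R :=
  ereal_inf [set s%:E
            | s in [set s : R | (0 <= s)%R /\ hausdorff_measure s A = 0]].

End hausdorff_dimension.

Section distributional_chaos.
Context {R : realType} {X : metricType R}.
Variable f : X -> X.

(* For n = 0 the value is 0, as 0^-1 = 0. *)
Definition close_freq (x y : X) (eps : R) (n : nat) : R :=
  n%:R^-1 * #|[pred i : 'I_n | mdist (iter i f x) (iter i f y) < eps]|%:R.

Definition lower_freq (x y : X) (eps : R) : \bar R :=
  limn_einf (fun n => (close_freq x y eps n)%:E).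

Definition upper_freq (x y : X) (eps : R) : \bar R :=
  limn_esup (fun n => (close_freq x y eps n)%:E).

Definition E_interval (p q : R) : set (X * X) :=
  [set z | upper_freq z.1 z.2 eps @[eps --> 0^'+] --> q%:E /\
           lower_freq z.1 z.2 eps @[eps --> 0^'+] --> p%:E].

Definition D_interval (p q : R) : set (X * X) :=
  [set z | exists2 eps0 : R, 0 < eps0 &
    forall eps, 0 < eps <= eps0 ->
      upper_freq z.1 z.2 eps = q%:E /\ lower_freq z.1 z.2 eps = p%:E].

Definition E_family (J : set (set R)) : set (X * X) :=
  [set z | exists p q,
    [/\ p <= q, J `[p, q]%classic & E_interval p q z]].

Definition D_family (J : set (set R)) : set (X * X) :=
  [set z | exists p q,
    [/\ p <= q, J `[p, q]%classic & D_interval p q z]].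

End distributional_chaos.

Definition compact_subinterval01 (R : realType) (I : set R) : Prop :=
  exists p q : R, [/\ 0 <= p, p <= q, q <= 1 & I = `[p, q]%classic].

(* R is a phantom parameter: it determines where the metric takes its values. *)
Definition shift_space (R : realType) (K : nat) : Type := nat -> 'I_K.

HB.instance Definition _ (R : realType) (K : nat) :=
  Choice.copy (shift_space R K) (nat -> 'I_K).

Section shift_space_metric.
Context {R : realType} {K : nat}.
Implicit Types x y z : shift_space R K.

Definition shift_dist x y : R :=
  if pselect (exists i, x i != y i) is left xy then K%:R ^- ex_minn xy else 0.

Let K_gt0 x : (0 < K)%N.
Proof. by case: (x 0) => m; exact: leq_trans. Qed.

Let shift_dist_ge0 x y : 0 <= shift_dist x y.
Proof.
by rewrite /shift_dist; case: pselect => // xy; rewrite invr_ge0 exprn_ge0.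
Qed.

Let shift_distxx x : shift_dist x x = 0.
Proof. by rewrite /shift_dist; case: pselect => // xx; case: (xx) => i; case/eqP. Qed.

Let shift_dist_positivity x y : shift_dist x y = 0 -> x = y.
Proof.
rewrite /shift_dist; case: pselect => [xy /eqP|xy _].
  by rewrite invr_eq0 expf_eq0 pnatr_eq0 (negPf (lt0n_neq0 (K_gt0 x))) andbF.
by apply/funext => i; apply/eqP/negPn/negP => xyi; apply: xy; exists i.
Qed.

Let shift_dist_sym x y : shift_dist x y = shift_dist y x.
Proof.
rewrite /shift_dist; case: pselect => xy; case: pselect => yx //.
- congr (_ ^- _); apply: eq_ex_minn => i; by rewrite eq_sym.
- by case: yx; case: xy => i; rewrite eq_sym; exists i.
- by case: xy; case: yx => i; rewrite eq_sym; exists i.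
Qed.

Let shift_dist_ultra y x z :
  shift_dist x z <= Num.max (shift_dist x y) (shift_dist y z).
Proof.
have le_pow (m n : nat) : (m <= n)%N -> K%:R ^- n <= K%:R ^- m :> R.
  move=> mn; rewrite lef_pV2 ?posrE ?exprn_gt0 ?ltr0n ?(K_gt0 x)//.
  by rewrite ler_weXn2l// ler1n (K_gt0 x).
have dist_ge (u v : shift_space R K) i :
    u i != v i -> K%:R ^- i <= shift_dist u v.
  move=> uvi; rewrite /shift_dist; case: pselect => [uv|[]]; last by exists i.
  by apply: le_pow; case: ex_minnP => m _; apply.
rewrite {1}/shift_dist; case: pselect => [xz|_]; last first.
  by rewrite le_max shift_dist_ge0.
case: ex_minnP => m xzm _; rewrite le_max.
case: (eqVneq (x m) (y m)) => [xym|/dist_ge -> //].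
by rewrite xym in xzm; rewrite (dist_ge _ _ _ xzm) orbT.
Qed.

Let shift_dist_triangle y x z :
  shift_dist x z <= shift_dist x y + shift_dist y z.
Proof.
apply: le_trans (shift_dist_ultra y x z) _.
by rewrite ge_max lerDl lerDr !shift_dist_ge0.
Qed.

HB.instance Definition _ := isMetric.Build R (shift_space R K)
  shift_distxx shift_dist_positivity shift_dist_sym shift_dist_triangle.

End shift_space_metric.

Definition shift_map (R : realType) (K : nat) (x : shift_space R K) :
  shift_space R K := fun i => x i.+1.

(* Main.v *)
Require Import Defs.
From mathcomp Require Import all_boot all_order all_algebra.
From mathcomp Require Import all_classical all_reals all_analysis.
From mathcomp Require Import ring lra zify.

Set Implicit Arguments.
Unset Strict Implicit.
Unset Printing Implicit Defensive.

Import Order.TTheory GRing.Theory Num.Theory.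
Import numFieldNormedType.Exports.

Local Open Scope classical_set_scope.
Local Open Scope ring_scope.

(**
Upper bound.  If the upper frequency of closeness is at least q at every scale,
then for every window length m and every eta > 0 there are infinitely many n
such that x and y agree on the whole window [i, i + m) for at least (q - eta) n
of the indices i < n.  Cut [0, L m) into L blocks of length m: a window starting
in a block forces agreement on the corresponding tail of that block, so the
number of windows is at most the sum over the blocks of the number of agreeing
tails.  The exponential moment (to base K) of this number over all pairs of
m-words is at most (m + 1) K ^ (2 m), so the Chernoff bound leaves about
((m + 1) K ^ ((2 - q) m)) ^ L cylinders of size K ^ (- L m), and (m + 1) ^ (1 / m)
tends to 1.

Lower bound.  Choose a set of positions with lower and upper densities p and q,
made of long runs.  Let y = x on it, y <> x at the multiples of M outside it, and
leave the remaining coordinates free: all small closeness scales then have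
frequencies exactly p and q.  Feeding the base K digits of t in [0, 1) into the
free coordinates, a piece of a cover of diameter K ^ (- n) pulls back into an
interval of length about K ^ (- (2 - q - 1 / M) n), and countable subadditivity
of Lebesgue measure bounds the Hausdorff measure from below.
*)

(** * Metric and Hausdorff dimension *)

Section shift_metric.
Context {R : realType} {K : nat}.
Hypothesis K_gt1 : (1 < K)%N.
Implicit Types x y : shift_space R K.

Let K1 : 1 < K%:R :> R. Proof. by rewrite ltr1n. Qed.
Let K0 : 0 < K%:R :> R. Proof. exact: lt_trans K1. Qed.

(** A nonzero distance is [K ^- m] with [m] the first disagreement, so closed balls of radius
    [K ^- n] are cylinders. *)
Lemma shift_mdist_le x y n :
  mdist x y <= K%:R ^- n <-> forall i, (i < n)%N -> x i = y i.
Proof.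
rewrite /mdist/= /shift_dist; case: pselect => [xy|xy]; last first.
  split=> [_ i _|_]; last by rewrite invr_ge0 exprn_ge0// ltW.
  by apply/eqP/negPn/negP => xyi; apply: xy; exists i.
case: ex_minnP => m xym minm.
rewrite lef_pV2 ?posrE ?exprn_gt0// ler_eXn2l//.
split=> [nm i im|xyn].
  apply/eqP/negPn/negP => /minm; rewrite leqNgt => /negP; apply.
  exact: leq_trans nm.
by rewrite leqNgt; apply/negP => /xyn/eqP; apply/negP.
Qed.

Lemma shift_mdist2_le (z w : shift_space R K * shift_space R K) n :
  mdist z w <= K%:R ^- n <->
  forall i, (i < n)%N -> z.1 i = w.1 i /\ z.2 i = w.2 i.
Proof.
rewrite [mdist z w]/(prod_mdist z w) /prod_mdist ge_max; split.
  by case/andP => /shift_mdist_le h1 /shift_mdist_le h2 i im; rewrite h1 ?h2.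
by move=> h; apply/andP; split; apply/shift_mdist_le => i /h[].
Qed.

Lemma iter_shift_mapE n x i : iter n (@shift_map R K) x i = x (n + i)%N.
Proof. by elim: n i => // n IH i; rewrite iterS /shift_map IH addSnnS. Qed.

Lemma close_iterP (x y : shift_space R K) i n :
  mdist (iter i (@shift_map R K) x) (iter i (@shift_map R K) y) <= K%:R ^- n <->
  forall r, (r < n)%N -> x (i + r)%N = y (i + r)%N.
Proof.
by split=> [/shift_mdist_le|] h;
  [move=> r /h | apply/shift_mdist_le => r /h]; rewrite !iter_shift_mapE.
Qed.

Lemma exprVn_lt (e : R) : 0 < e -> exists n, K%:R ^- n < e.
Proof.
move=> e0; exists (Num.truncn e^-1).+1.
rewrite invf_plt ?posrE ?exprn_gt0//.
apply: (lt_le_trans (truncnS_gt _)).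
by rewrite -natrX ler_nat ltnW// ltn_expl.
Qed.

End shift_metric.

Section hausdorff_dimension.
Context {R : realType} {T : metricType R}.
Implicit Types A B : set T.
Local Open Scope ereal_scope.

Lemma diam_ge0 A : 0 <= diam A.
Proof. by apply: ereal_sup_ubound; left. Qed.

Lemma diam_pow_ge0 (s : R) A : 0 <= diam_pow s A.
Proof. by rewrite /diam_pow; case: ifP => // _; exact: poweR_ge0. Qed.

Lemma mdist_le_diam A (x y : T) : A x -> A y -> (mdist x y)%:E <= diam A.
Proof. by move=> Ax Ay; apply: ereal_sup_ubound; right; exists (x, y). Qed.

Lemma diam_le A (r : R) : (0 <= r)%R ->
  (forall x y, A x -> A y -> (mdist x y <= r)%R) -> diam A <= r%:E.
Proof.
move=> r0 h; apply: ge_ereal_sup => _ [->|[[x y] [/= Ax Ay] <-]].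
- by rewrite lee_fin.
- by rewrite lee_fin h.
Qed.

Lemma diam_pow_le (s r : R) A : (0 <= s)%R -> (0 <= r)%R ->
  (forall x y, A x -> A y -> (mdist x y <= r)%R) ->
  diam_pow s A <= (r `^ s)%:E.
Proof.
move=> s0 r0 h; rewrite /diam_pow; case: ifP => _; first by rewrite lee_fin powR_ge0.
rewrite -poweR_EFin gt0_ler_poweR ?in_itv/= ?leey ?andbT ?diam_ge0 ?lee_fin//.
exact: diam_le.
Qed.

Lemma hausdorff_premeasure_ge0 s delta A : 0 <= hausdorff_premeasure s delta A.
Proof.
apply: le_ereal_inf_tmp => _ [U _ <-]; apply: nneseries_ge0 => n _ _.
exact: diam_pow_ge0.
Qed.

Lemma hausdorff_measure_ge0 s A : 0 <= hausdorff_measure s A.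
Proof.
apply: le_trans (hausdorff_premeasure_ge0 s 1 A) _.
by apply: ereal_sup_ubound; exists 1%R => //=; exact: ltr01.
Qed.

Lemma le_hausdorff_measure s A B : A `<=` B ->
  hausdorff_measure s A <= hausdorff_measure s B.
Proof.
move=> AB; apply: ge_ereal_sup => _ [delta d0 <-].
apply: (@le_trans _ _ (hausdorff_premeasure s delta B)).
  apply: ereal_inf_le_tmp => _ [U [BU dU] <-]; exists U => //; split => //.
  exact: subset_trans BU.
by apply: ereal_sup_ubound; exists delta.
Qed.

Lemma le_hausdorff_dim A B : A `<=` B -> hausdorff_dim A <= hausdorff_dim B.
Proof.
move=> AB; apply: ereal_inf_le_tmp => _ [s [s0 HB] <-]; exists s => //; split => //.
apply/eqP; rewrite eq_le hausdorff_measure_ge0 andbT -HB.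
exact: le_hausdorff_measure.
Qed.

End hausdorff_dimension.

Section countable_covers.
Context {R : realType} {T : metricType R}.
Local Open Scope ereal_scope.

Lemma nneseries_nth (U : Type) (u0 : U) (s : seq U) (g : U -> \bar R) :
  (forall u, 0 <= g u) -> g u0 = 0 ->
  \sum_(0 <= j <oo) g (nth u0 s j) = \sum_(u <- s) g u.
Proof.
move=> g0 gu0; rewrite nneseries_esumT//.
rewrite (big_nth u0) big_mkord (fsbig_ord _ _ (fun j => g (nth u0 s j))) -esum_fset//.
rewrite [RHS]esum_mkcond; apply: eq_esum => j _.
by case: ifPn => //; rewrite notin_setE /= => /negP; rewrite -leqNgt => h; rewrite nth_default.
Qed.

(** Lets a cover come as one finite list per level. The pairs (level, index) are numbered by
    [pickle]; integers that are no code, and indices past the end of a list, give [set0], which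
    costs 0 by the convention in [diam_pow]. *)
Lemma hausdorff_premeasure_le (s delta : R) (A : set T)
    (F : nat -> seq (set T)) : (0 <= delta)%R ->
  (forall L j, diam (nth set0 (F L) j) <= delta%:E) ->
  A `<=` \bigcup_L \bigcup_j nth set0 (F L) j ->
  hausdorff_premeasure s delta A <=
    \sum_(0 <= L <oo) \sum_(U <- F L) diam_pow s U.
Proof.
move=> d0 Fdelta AF.
pose U i := if pickle_inv i is Some p then nth set0 (F p.1) p.2 else set0.
have set00 : diam_pow s (@set0 T) = 0 by rewrite /diam_pow eqxx.
have UE p : U (pickle p) = nth set0 (F p.1) p.2 by rewrite /U pickleK_inv.
apply: (@le_trans _ _ (\sum_(0 <= i <oo) diam_pow s (U i))).
  apply: ereal_inf_lbound; exists U => //; split.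
    move=> x /AF[L _ [j _ Fx]]; exists (pickle (L, j)) => //.
    by rewrite UE.
  move=> i; rewrite /U; case: pickle_inv => [p|]; first exact: Fdelta.
  by apply: diam_le.
rewrite nneseries_esumT; last by move=> *; exact: diam_pow_ge0.
rewrite (_ : esum _ _ =
    \esum_(p in setT) diam_pow s (nth set0 (F p.1) p.2)); last first.
  rewrite [RHS](@eq_esum _ _ _ _ (fun p => diam_pow s (U (pickle p)))); last first.
    by move=> p _ /=; rewrite UE.
  transitivity (\esum_(i in range (@pickle (nat * nat)%type)) diam_pow s (U i));
    last first.
    apply: (@reindex_esum _ _ _ setT _ pickle (diam_pow s \o U)).
    by split => [p _|x y _ _|_ [p _ <-]];
      [exists p|exact: (pcan_inj pickleK)|exists p].
  rewrite [RHS]esum_mkcond; apply: eq_esum => i _.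
  case: ifPn => //; rewrite notin_setE => ni; rewrite /= /U.
  case Ei: pickle_inv => [p|//]; exfalso; apply: ni; exists p => //.
  by have := pickle_invK (T:=(nat * nat)%type) i; rewrite /oapp Ei.
rewrite (_ : [set: nat * nat] = setT `*`` (fun=> setT)); last first.
  by apply/seteqP; split.
rewrite -(@esum_esum _ _ _ setT (fun=> setT)
  (fun L j => diam_pow s (nth set0 (F L) j))); last by move=> *; exact: diam_pow_ge0.
rewrite nneseries_esumT; last by move=> L; apply: sume_ge0 => u _; exact: diam_pow_ge0.
rewrite le_eqVlt; apply/orP; left; apply/eqP; apply: eq_esum => L _.
rewrite -nneseries_esumT; last by move=> *; exact: diam_pow_ge0.
by apply: nneseries_nth => // u; exact: diam_pow_ge0.
Qed.

Lemma hausdorff_measure_eq0 (s : R) (A : set T) :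
  (forall delta e : R, (0 < delta)%R -> (0 < e)%R ->
    exists F : nat -> seq (set T),
    [/\ forall L j, diam (nth set0 (F L) j) <= delta%:E,
        A `<=` \bigcup_L \bigcup_j nth set0 (F L) j &
        \sum_(0 <= L <oo) \sum_(U <- F L) diam_pow s U <= e%:E]) ->
  hausdorff_measure s A = 0.
Proof.
move=> h; apply/eqP; rewrite eq_le hausdorff_measure_ge0 andbT.
apply: ge_ereal_sup => _ [delta d0 <-]; apply/lee_addgt0Pr => e e0; rewrite add0e.
have [F [Fd AF Fe]] := h _ _ d0 e0.
by apply: le_trans (hausdorff_premeasure_le s (ltW d0) Fd AF) Fe.
Qed.

End countable_covers.

(** * Upper bound *)

Section block_counting.
Local Open Scope nat_scope.
Context {K m : nat}.
Local Notation block := {ffun 'I_m -> 'I_K * 'I_K}.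
Implicit Types b : block.

Definition tail_agree b (r : nat) : bool :=
  [forall r' : 'I_m, (r <= r') ==> ((b r').1 == (b r').2)].

Definition num_tail_agree b : nat := \sum_(r < m) tail_agree b r.

Lemma sum_leq_ord (n r : nat) : \sum_(i < n) (r <= i) = n - r.
Proof.
elim: n => [|n IH]; first by rewrite big_ord0.
by rewrite big_ord_recr /= IH; case: leqP; lia.
Qed.

(* If r0 is the earliest agreeing tail, only the term r = r0 is needed. *)
Lemma exp_num_tail_agree_le b : 0 < K ->
  K ^ num_tail_agree b <= 1 + \sum_(r < m) tail_agree b r * K ^ (m - r).
Proof.
move=> K0; case: (pickP (fun r : 'I_m => tail_agree b r)) => [r1 ar1|none].
  case: (@arg_minnP _ r1 (fun r : 'I_m => tail_agree b r) val ar1) => r0 ar0 minr0.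
  apply: leq_trans (leq_addl _ _); rewrite (bigD1 r0)//= ar0 mul1n.
  apply: leq_trans (leq_addr _ _); rewrite leq_pexp2l// -sum_leq_ord.
  by apply: leq_sum => r _; case E: (tail_agree b r) => //; rewrite minr0.
by rewrite /num_tail_agree big1 ?expn0 ?leq_addr// => r _; rewrite none.
Qed.

Lemma prod_tail (n r : nat) :
  \prod_(i < n) (if r <= i then K else K * K) * K ^ (n - r) = K ^ (2 * n).
Proof.
elim: n => [|n IH]; first by rewrite big_ord0.
rewrite big_ord_recr /=; case: leqP => rn.
  by rewrite subSn// expnS mulnS expnD -IH expnS expn1; ring.
have -> : n.+1 - r = 0 by lia.
have E : n - r = 0 by lia.
by rewrite mulnS expnD -IH E !expnS !expn0; ring.
Qed.

(** The tail condition divides the number of pairs of words by [K ^ (m - r)]; the identity is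
    multiplied out to avoid division. The indicator is a product over positions, so the sum over
    blocks factors. *)
Lemma sum_tail_agree (r : nat) :
  (\sum_(b : block) tail_agree b r) * K ^ (m - r) = K ^ (2 * m).
Proof.
pose G (i : 'I_m) (c : 'I_K * 'I_K) : nat := (r <= i) ==> (c.1 == c.2).
rewrite -(prod_tail m r); congr (_ * _).
have -> : \sum_(b : block) tail_agree b r = \sum_(b : block) \prod_i G i (b i).
  apply: eq_bigr => b _; case: (boolP (tail_agree b r)) => [/forallP h|/forallPn[i hi]].
    by rewrite big1// => i _; rewrite /G h.
  by rewrite (bigD1 i)//= /G (negPf hi).
rewrite -bigA_distr_bigA; apply: eq_bigr => i _; rewrite /G.
case: leqP => _ /=; last by rewrite sum1_card card_prod !card_ord.
rewrite -(pair_bigA _ (fun a c : 'I_K => (a == c) : nat)) /=.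
rewrite -[RHS](card_ord K) -sum1_card; apply: eq_bigr => a _.
by rewrite (bigD1 a)//= eqxx big1// => c; rewrite eq_sym => /negPf ->.
Qed.

(** The weight [K ^ (m - r)] exactly offsets the rarity of an agreeing tail at [r]: each of the [m]
    values of [r], and the constant term 1, contributes [K ^ (2 * m)]. *)
Lemma sum_exp_num_tail_agree : 0 < K ->
  \sum_(b : block) K ^ num_tail_agree b <= m.+1 * K ^ (2 * m).
Proof.
move=> K0.
apply: (@leq_trans (\sum_(b : block) (1 + \sum_(r < m) tail_agree b r * K ^ (m - r)))).
  by apply: leq_sum => b _; exact: exp_num_tail_agree_le.
rewrite big_split /= sum1_card card_ffun card_prod !card_ord exchange_big /=.
rewrite (eq_bigr (fun=> K ^ (2 * m))); last first.
  by move=> r _; rewrite -big_distrl /= sum_tail_agree.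
by rewrite sum_nat_const card_ord mulnn -expnM mulSn.
Qed.

Lemma sum_exp_num_tail_agree_words (L : nat) : 0 < K ->
  \sum_(w : {ffun 'I_L -> block})
     K ^ (\sum_l num_tail_agree (w l)) <= (m.+1 * K ^ (2 * m)) ^ L.
Proof.
move=> K0.
rewrite (eq_bigr (fun w : {ffun 'I_L -> block} =>
   \prod_l K ^ num_tail_agree (w l))); last by move=> w _; rewrite expn_sum.
rewrite -(bigA_distr_bigA (fun _ b => K ^ num_tail_agree b)) prod_nat_const card_ord.
by case: L => // L; rewrite leq_exp2r// sum_exp_num_tail_agree.
Qed.

End block_counting.

(** * Covers by cylinders with many agreeing tails *)

Section upper_bound.
Context {R : realType} {K : nat}.
Hypothesis K_gt1 : (1 < K)%N.
Local Notation X := (shift_space R K).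

Let K1 : 1 < K%:R :> R. Proof. by rewrite ltr1n. Qed.
Let K0 : 0 < K%:R :> R. Proof. exact: lt_trans K1. Qed.
Let Kge0 : 0 <= K%:R :> R. Proof. exact: ltW. Qed.
Let Kge1 : 1 <= K%:R :> R. Proof. exact: ltW. Qed.
Let Kneq0 : K%:R != 0 :> R. Proof. by rewrite gt_eqF. Qed.

Definition agree_run (x y : nat -> 'I_K) (m i : nat) : bool :=
  [forall r : 'I_m, x (i + r)%N == y (i + r)%N].

Definition agree_count (x y : nat -> 'I_K) (m n : nat) : nat :=
  \sum_(i < n) agree_run x y m i.

Definition block_pair (x y : nat -> 'I_K) (m l : nat) :
    {ffun 'I_m -> 'I_K * 'I_K} :=
  [ffun r : 'I_m => (x (l * m + r)%N, y (l * m + r)%N)].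

Lemma leq_agree_count x y m n n' :
  (n <= n')%N -> (agree_count x y m n <= agree_count x y m n')%N.
Proof.
move=> /subnKC <-; rewrite /agree_count big_split_ord /=.
exact: leq_addr.
Qed.

Lemma agree_count_blocks x y m L :
  (agree_count x y m (L * m) <= \sum_(l < L) num_tail_agree (block_pair x y m l))%N.
Proof.
elim: L => [|L IH]; first by rewrite mul0n /agree_count !big_ord0.
rewrite mulSnr /agree_count big_split_ord big_ord_recr /=.
apply: leq_add => //; apply: leq_sum => r _.
case: (boolP (agree_run _ _ _ _)) => // /forallP h.
suff -> : tail_agree (block_pair x y m L) r by [].
apply/forallP => r'; apply/implyP => rr'; rewrite !ffunE /=.
have r'm : (r' - r < m)%N by apply: leq_ltn_trans (ltn_ord r'); exact: leq_subr.
by have := h (Ordinal r'm); rewrite /= -addnA subnKC.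
Qed.

Definition cylinder m L (w : {ffun 'I_L -> {ffun 'I_m -> 'I_K * 'I_K}}) :
    set (X * X) :=
  [set z | forall l : 'I_L, block_pair z.1 z.2 m l = w l].

Lemma cylinder_mdist m L (w : {ffun 'I_L -> {ffun 'I_m -> 'I_K * 'I_K}}) z z' :
  cylinder w z -> cylinder w z' -> mdist z z' <= K%:R ^- (L * m).
Proof.
move=> wz wz'; apply/(shift_mdist2_le K_gt1) => i im.
have m0 : (0 < m)%N by case: m im {w wz wz'} => //; rewrite muln0.
have lL : (i %/ m < L)%N by rewrite ltn_divLR.
have := etrans (wz (Ordinal lL)) (esym (wz' (Ordinal lL))).
move/ffunP => /(_ (Ordinal (ltn_pmod i m0))); rewrite !ffunE /= -divn_eq.
by case.
Qed.

(** Chernoff bound. As [s = (2 + eta) - (q - eta)], a word with at least [(q - eta) * L * m]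
    agreeing tails has weight at most [c] times [K] to the number of its tails; the sum may then run
    over all words, where the moment bound applies. *)
Lemma level_sum_le (q eta s : R) m L :
  0 <= s -> s = 2 - q + 2 * eta ->
  (\sum_(w : {ffun 'I_L -> {ffun 'I_m -> 'I_K * 'I_K}} |
      ((q - eta) * (L * m)%:R <= (\sum_l num_tail_agree (w l))%N%:R)%R)
     diam_pow s (cylinder w) <=
   ((m.+1%:R * K%:R `^ (- eta * m%:R)) ^+ L)%:E)%E.
Proof.
move=> s0 sE.
pose c : R := K%:R `^ (- (2 + eta) * (L * m)%:R).
apply: (@le_trans _ _ (\sum_(w : {ffun 'I_L -> {ffun 'I_m -> 'I_K * 'I_K}})
    ((K ^ \sum_l num_tail_agree (w l))%:R * c)%:E)%E).
  rewrite big_mkcond /=; apply: lee_sum => w _; case: ifPn => [good|_]; last first.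
    by rewrite lee_fin mulr_ge0// powR_ge0.
  apply: le_trans (diam_pow_le s0 _ (@cylinder_mdist m L w)) _.
    by rewrite invr_ge0 exprn_ge0 ?ltW.
  rewrite lee_fin.
  rewrite -powR_mulrn ?Kge0// -powRN -powRrM natrX -powR_mulrn ?Kge0// -powRD ?Kneq0 ?implybT//.
  by rewrite ler_powR ?Kge1//; move: good; rewrite sE; lra.
rewrite sumEFin lee_fin -mulr_suml -natr_sum.
apply: (@le_trans _ _ (((m.+1 * K ^ (2 * m)) ^ L)%:R * c)).
  by rewrite ler_wpM2r ?powR_ge0// ler_nat sum_exp_num_tail_agree_words// ltnW.
have -> : c = (K%:R `^ (- (2 + eta) * m%:R)) ^+ L.
  by rewrite -powR_mulrn ?powR_ge0// -powRrM /c natrM; congr (_ `^ _); ring.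
rewrite natrX natrM natrX -exprMn -mulrA -powR_mulrn ?Kge0// -powRD ?Kneq0 ?implybT//.
rewrite le_eqVlt; apply/orP; left; apply/eqP; congr (( _ * _) ^+ _).
by congr (_ `^ _); rewrite natrM; ring.
Qed.

(** A large [n] in the condition puts the pair in a cylinder of some level [L >= L0], and the total
    weights of the levels decrease geometrically. The loss from [eta / 2] to [eta] pays for rounding
    [n] up to a multiple of [m]. *)
Lemma hausdorff_measure_agree_eq0 (q eta s : R) m :
  0 < eta -> (0 < m)%N -> q <= 1 -> 0 <= s -> s = 2 - q + 2 * eta ->
  m.+1%:R * K%:R `^ (- eta * m%:R) <= 4^-1 ->
  hausdorff_measure s [set z : X * X | forall N, exists2 n, (N <= n)%N &
    (q - eta / 2) * n%:R <= (agree_count z.1 z.2 m n)%:R] = 0.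
Proof.
move=> eta0 m0 q1 s0 sE theta; apply: hausdorff_measure_eq0 => delta e d0 e0.
have [L1 L1d] := exprVn_lt K_gt1 d0.
have [L2 L2e] : exists n, (2%:R : R) ^- n < e / 2.
  by apply: exprVn_lt => //; rewrite divr_gt0.
pose L3 := (Num.truncn (2 / eta)).+1.
have L3eta : 2 / eta <= L3%:R by apply/ltW/truncnS_gt.
(* [L1] makes the diameters at most [delta], [L2] the total weight at most [e], [L3] the rounding
   error [m] at most [eta / 2 * n]. *)
pose L0 := (L1 + L2 + L3)%N.
pose W L := {ffun 'I_L -> {ffun 'I_m -> 'I_K * 'I_K}}.
pose good L (w : W L) := (q - eta) * (L * m)%:R <= (\sum_l num_tail_agree (w l))%N%:R.
pose F L := if (L < L0)%N then [::] else
  [seq cylinder w | w <- enum (@good L)].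
exists F; split.
- move=> L j; rewrite /F; case: ltnP => L0L.
    by rewrite nth_nil; apply: diam_le => //; exact: ltW.
  have [jL|jL] := ltnP j (size [seq cylinder w | w <- enum (@good L)]); last first.
    by rewrite nth_default//; apply: diam_le => //; exact: ltW.
  have /mapP[w _ ->] := mem_nth set0 jL.
  apply: diam_le; first exact: ltW.
  move=> z z' wz wz'; apply: le_trans (cylinder_mdist wz wz') _.
  apply: le_trans (ltW L1d); rewrite lef_pV2 ?posrE ?exprn_gt0// ler_eXn2l//.
  by rewrite -[leqLHS]muln1 leq_mul//; apply: leq_trans L0L; rewrite /L0 -addnA leq_addr.
- move=> [x y] /= /(_ (L0 * m)%N)[n Nn nq].
  pose L := (n %/ m).+1.
  have L0L : (L0 <= L)%N by rewrite /L leqW// leq_divRL.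
  have nL : (n <= L * m)%N by rewrite ltnW// ltn_ceil.
  have Ln : (L * m <= n + m)%N by rewrite /L mulSnr leq_add2r leq_trunc_div.
  pose w : W L := [ffun l : 'I_L => block_pair x y m l].
  have wgood : good L w.
    (* For [q - eta <= 0] every word is good; otherwise [L * m <= n + m] can be multiplied by it. *)
    rewrite /good; have [qeta|qeta] := lerP (q - eta) 0.
      by apply: le_trans (ler0n _ _); rewrite mulr_le0_ge0.
    apply: (@le_trans _ _ ((agree_count x y m (L * m))%:R)); last first.
      rewrite ler_nat; apply: leq_trans (agree_count_blocks _ _ _ _) _.
      by apply: leq_sum => l _; rewrite ffunE.
    apply: (@le_trans _ _ ((agree_count x y m n)%:R)); last first.
      by rewrite ler_nat leq_agree_count.
    apply: le_trans nq.
    have h1 : (L * m)%:R <= n%:R + m%:R :> R by rewrite -natrD ler_nat.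
    have h2 : 2 / eta * m%:R <= n%:R.
      apply: (@le_trans _ _ ((L0 * m)%:R)); last by rewrite ler_nat.
      rewrite natrM ler_wpM2r//; apply: le_trans L3eta _.
      by rewrite ler_nat /L0 leq_addl.
    have h3 : m%:R <= eta / 2 * n%:R.
      rewrite -[leLHS](_ : eta / 2 * (2 / eta * m%:R) = _); last by field; lra.
      by rewrite ler_wpM2l// divr_ge0// ltW.
    have m0' : 0 <= m%:R :> R by [].
    have h4 : (q - eta) * (L * m)%:R <= (q - eta) * (n%:R + m%:R).
      by rewrite ler_wpM2l// ltW.
    by nra.
  exists L => //; exists (index (cylinder w) (F L)) => //=.
  rewrite nth_index; first by move=> l; rewrite ffunE.
  by rewrite /F ltnNge L0L /=; apply: map_f; rewrite mem_enum.
(* Level [L] may spend [e / 2 ^ (L + 1)]. Its weight is at most [4 ^- L = 2 ^- L * 2 ^- L], and one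
   factor is below [e / 2] once [L >= L2]. *)
- apply: le_trans (epsilon_trick0 xpredT (ltW e0)); apply: lee_nneseries.
    by move=> L _ _; apply: sume_ge0 => U _; exact: diam_pow_ge0.
  move=> L _; rewrite /F; case: ltnP => L0L.
    by rewrite big_nil lee_fin divr_ge0 ?ltW.
  rewrite big_map big_enum.
  apply: le_trans (@level_sum_le q eta s m L s0 sE) _; rewrite lee_fin.
  apply: (@le_trans _ _ (4^-1 ^+ L)).
    by rewrite lerXn2r// nnegrE ?mulr_ge0 ?powR_ge0.
  rewrite (_ : 4 = 2 * 2)%R; last by ring.
  rewrite invfM exprMn natrX exprS invfM mulrA ler_pM ?exprn_ge0// ?invr_ge0// -?exprVn//.
  rewrite exprVn; apply: le_trans (ltW L2e); rewrite lef_pV2 ?posrE ?exprn_gt0//.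
  rewrite ler_eXn2l ?ltr1n//; apply: leq_trans L0L.
  by rewrite /L0 addnAC leq_addl.
Qed.

End upper_bound.

Section limn_esup.
Context {R : realType}.
Local Open Scope ereal_scope.

Lemma limn_esup_le (u : nat -> \bar R) (l : \bar R) (N : nat) :
  (forall n, (N <= n)%N -> u n <= l) -> limn_esup u <= l.
Proof.
move=> ul; apply: (@le_trans _ _ (ereal_sup (u @` [set n | (N <= n)%N]))).
  by apply: ereal_inf_lbound; exists [set n | (N <= n)%N] => //; exact: nbhs_infty_ge.
by apply: ge_ereal_sup => _ [n /= Nn <-]; exact: ul.
Qed.

Lemma limn_esup_ge (u : nat -> \bar R) (l : \bar R) :
  (forall N, exists2 n, (N <= n)%N & l <= u n) -> l <= limn_esup u.
Proof.
move=> ul; apply: le_ereal_inf_tmp => _ [A [N _ NA] <-].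
have [n Nn lu] := ul N; apply: le_trans lu _.
by apply: ereal_sup_ubound; exists n => //; exact: NA.
Qed.

Lemma limn_esup_EFinE (u : nat -> R) (l : R) :
  (forall e, 0 < e -> exists N, forall n, (N <= n)%N -> u n <= l + e)%R ->
  (forall e, 0 < e -> forall N, exists2 n, (N <= n)%N & l - e <= u n)%R ->
  limn_esup (fun n => (u n)%:E) = l%:E.
Proof.
move=> hle hge; apply/eqP; rewrite eq_le; apply/andP; split.
  apply/lee_addgt0Pr => e /hle[N uN]; apply: (@limn_esup_le _ _ N) => n Nn.
  by rewrite lee_fin uN.
apply/lee_subgt0Pr => e /hge h; apply: limn_esup_ge => N.
by have [n Nn] := h N; exists n => //; rewrite -EFinB lee_fin.
Qed.

Lemma limn_einf_EFinE (u : nat -> R) (l : R) :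
  (forall e, 0 < e -> exists N, forall n, (N <= n)%N -> l - e <= u n)%R ->
  (forall e, 0 < e -> forall N, exists2 n, (N <= n)%N & u n <= l + e)%R ->
  limn_einf (fun n => (u n)%:E) = l%:E.
Proof.
move=> hge hle; rewrite /limn_einf.
rewrite (_ : limn_esup _ = (- l)%:E) ?EFinN ?oppeK//.
apply: (@limn_esup_EFinE (fun n => - u n)%R) => e e0.
  by have [N hN] := hge _ e0; exists N => n /hN; lra.
by move=> N; have [n Nn h] := hle _ e0 N; exists n => //; lra.
Qed.

End limn_esup.

Section upper_bound_dim.
Context {R : realType} {K : nat}.
Hypothesis K_gt1 : (1 < K)%N.
Local Notation X := (shift_space R K).

Lemma exists_small_rate (eta : R) : 0 < eta ->
  exists2 m, (0 < m)%N & m.+1%:R * K%:R `^ (- eta * m%:R) <= 4^-1 :> R.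
Proof.
move=> eta0.
have lnK : 0 < ln K%:R :> R by rewrite ln_gt0// ltr1n.
pose c := eta * ln (K%:R : R); have c0 : 0 < c by rewrite mulr_gt0.
(* With [c ^+ 2 * m >= 16], the quadratic term of the exponential series gives [expR (c * m) >= (c *
   m) ^+ 2 / 2 >= 8 * m >= 4 * (m + 1)]. *)
exists (Num.truncn (16 / c ^+ 2)).+1 => //; set m := (Num.truncn _).+1.
have mc : 16 <= c ^+ 2 * m%:R.
  rewrite mulrC -ler_pdivrMr ?exprn_gt0//; exact/ltW/truncnS_gt.
have m1 : 1 <= m%:R :> R by rewrite ler1n.
have K0 : K%:R != 0 :> R by rewrite pnatr_eq0; lia.
rewrite /powR (negPf K0) mulNr mulNr expRN ler_pdivrMr ?expR_gt0//.
rewrite mulrC ler_pdivlMr//.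
have cm0 : 0 <= eta * m%:R * ln (K%:R : R) by rewrite !mulr_ge0// ltW.
apply: le_trans (expR_ge1Dxn 1 cm0); rewrite -natr1.
have -> : eta * m%:R * ln (K%:R : R) = c * m%:R by rewrite /c; ring.
by rewrite exprMn (_ : 2`!%:R = 2 :> R)//; nra.
Qed.

Lemma upper_freq_agree_count (x y : X) (l eps : R) m :
  eps <= K%:R ^- m -> (l%:E < upper_freq (@shift_map R K) x y eps)%E ->
  forall N, exists2 n, (N <= n)%N & l * n%:R <= (agree_count x y m n)%:R.
Proof.
move=> epsm lu N; apply: contrapT => hn.
have : (upper_freq (@shift_map R K) x y eps <= l%:E)%E.
  apply: (@limn_esup_le _ _ _ N.+1) => n Nn.
  have n0 : 0 < n%:R :> R by rewrite ltr0n; lia.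
  rewrite lee_fin /close_freq mulrC ler_pdivrMr// leNgt; apply/negP => h.
  apply: hn; exists n; first exact: ltnW.
  apply/ltW/(lt_le_trans h); rewrite ler_nat -sum1_card big_mkcond /=.
  apply: leq_sum => i _; case: ifPn => // /= close.
  suff -> : agree_run x y m i by [].
  apply/forallP => r; apply/eqP.
  have /(close_iterP K_gt1) := le_trans (ltW close) epsm.
  by apply; exact: ltn_ord.
by rewrite leNgt lu.
Qed.

(** The window length [m] depends on [e] only, so a single null set contains the pairs of all
    intervals of [J], however many there are: each pair has a scale below [K ^- m] with upper
    frequency above [q - e / 4]. *)
Lemma hausdorff_dim_E_family_le (J : set (set R)) (q : R) : q <= 1 ->
  (forall a b, a <= b -> J `[a, b]%classic -> q <= b) ->
  (hausdorff_dim (E_family (@shift_map R K) J) <= (2 - q)%:E)%E.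
Proof.
move=> q1 Jq; apply/lee_addgt0Pr => e e0; rewrite -EFinD.
apply: ereal_inf_lbound; exists (2 - q + e) => //; split; first by lra.
have eta0 : 0 < e / 2 by lra.
have [m m0 mrate] := exists_small_rate eta0.
apply/eqP; rewrite eq_le hausdorff_measure_ge0 andbT.
have s0 : 0 <= 2 - q + e by lra.
have sE : 2 - q + e = 2 - q + 2 * (e / 2) by lra.
rewrite -(hausdorff_measure_agree_eq0 K_gt1 eta0 m0 q1 s0 sE mrate).
apply: le_hausdorff_measure => -[x y] [a [b [ab Jab [/= bE _]]]].
have qb := Jq _ _ ab Jab.
have Km0 : 0 < K%:R ^- m :> R by rewrite invr_gt0 exprn_gt0// ltr0n; lia.
have lb : ((q - e / 2 / 2)%:E < b%:E)%E by rewrite lte_fin; lra.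
have [eps epsm epsu] : exists2 eps, eps <= K%:R ^- m &
    ((q - e / 2 / 2)%:E < upper_freq (@shift_map R K) x y eps)%E.
  have /filter_ex[eps []] : \forall eps \near 0^'+, eps <= K%:R ^- m /\
    ((q - e / 2 / 2)%:E < upper_freq (@shift_map R K) x y eps)%E.
    apply: filterI; first exact: nbhs_right_le.
    have nb : nbhs b%:E [set u | ((q - e / 2 / 2)%:E < u)%E].
      by apply: open_nbhs_nbhs; split => //; exact: open_ereal_gt_ereal.
    have := bE _ nb; exact.
  by exists eps.
exact: upper_freq_agree_count epsm epsu.
Qed.

End upper_bound_dim.

(** * A word with prescribed densities *)

Section quadratic_error_frequency.
Context {R : realType}.

Lemma sqrt_interval (n : nat) : exists k, (k ^ 2 <= n < k.+1 ^ 2)%N.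
Proof.
elim: n => [|n [k /andP[k1 k2]]]; first by exists 0%N.
have [h|h] := ltnP n.+1 (k.+1 ^ 2); first by exists k; rewrite h leqW.
exists k.+1; rewrite h /=; apply: (leq_ltn_trans k2).
by rewrite ltn_exp2r.
Qed.

(** For [k ^ 2 <= n] the error [D * k.+1] is of the order of the square root of [n] and vanishes
    after division by [n]; the last two hypotheses say that the bounds are approached along
    squares. *)
Lemma limn_freq_sqrt_error (C : nat -> nat) (p q D : R) : 0 <= D ->
  (forall k n, (k ^ 2 <= n < k.+1 ^ 2)%N ->
    p * n%:R - D * k.+1%:R <= (C n)%:R <= q * n%:R + D * k.+1%:R) ->
  (forall N, exists2 k, (N <= k)%N &
    q * (k ^ 2)%:R - D * k.+1%:R <= (C (k ^ 2)%N)%:R) ->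
  (forall N, exists2 k, (N <= k)%N &
    (C (k ^ 2)%N)%:R <= p * (k ^ 2)%:R + D * k.+1%:R) ->
  limn_esup (fun n => (n%:R^-1 * (C n)%:R)%:E) = q%:E /\
  limn_einf (fun n => (n%:R^-1 * (C n)%:R)%:E) = p%:E.
Proof.
move=> D0 hC hq hp.
(* Since [k >= 1], [D * k.+1 <= 2 * D * k <= e * k ^ 2 <= e * n]. *)
have small e k n : 0 < e -> ((Num.truncn (2 * D / e)).+1 <= k)%N -> (k ^ 2 <= n)%N ->
    0 < n%:R :> R /\ D * k.+1%:R <= e * n%:R.
  move=> e0 kk kn.
  have k1 : 1 <= k%:R :> R by rewrite ler1n; lia.
  have Dk : 2 * D <= e * k%:R.
    rewrite [leRHS]mulrC -ler_pdivrMr//.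
    by apply: le_trans (ltW (truncnS_gt _)) _; rewrite ler_nat.
  have kn' : k%:R * k%:R <= n%:R :> R by rewrite -natrM ler_nat.
  by split; [nra | rewrite -natr1; nra].
split; [apply: limn_esup_EFinE | apply: limn_einf_EFinE] => e e0.
- exists ((Num.truncn (2 * D / e)).+1 ^ 2)%N => n Nn.
  have [k kn] := sqrt_interval n; have /andP[k1 k2] := kn.
  have [] := small e k n e0 _ k1.
    by have := leq_ltn_trans Nn k2; rewrite ltn_exp2r.
  move=> n0 hD; rewrite mulrC ler_pdivrMr//.
  by have /andP[_] := hC _ _ kn; nra.
- move=> N; have [k kN hk] := hq (maxn N (Num.truncn (2 * D / e)).+1).
  exists (k ^ 2)%N.
    by rewrite -mulnn; nia.
  have [] := small e k _ e0 _ (leqnn _); first by lia.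
  by move=> n0 hD; rewrite mulrC ler_pdivlMr//; nra.
- exists ((Num.truncn (2 * D / e)).+1 ^ 2)%N => n Nn.
  have [k kn] := sqrt_interval n; have /andP[k1 k2] := kn.
  have [] := small e k n e0 _ k1.
    by have := leq_ltn_trans Nn k2; rewrite ltn_exp2r.
  move=> n0 hD; rewrite mulrC ler_pdivlMr//.
  by have /andP[+ _] := hC _ _ kn; nra.
- move=> N; have [k kN hk] := hp (maxn N (Num.truncn (2 * D / e)).+1).
  exists (k ^ 2)%N.
    by rewrite -mulnn; nia.
  have [] := small e k _ e0 _ (leqnn _); first by lia.
  by move=> n0 hD; rewrite mulrC ler_pdivrMr//; nra.
Qed.

End quadratic_error_frequency.

(** * Counting the ones and the changes of the word *)

Section prescribed_density.
Context {R : realType}.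
Variables p q : R.
Hypotheses (p0 : 0 <= p) (pq : p <= q) (q1 : q <= 1).

(* The phases [2 ^ 2 ^ r, 2 ^ 2 ^ r.+1) grow so fast that each one swamps all
   the previous ones, so both densities are approached infinitely often. *)
Definition phase_density (k : nat) : R :=
  if odd (trunc_log 2 (trunc_log 2 k)) then q else p.

Definition block_ones (k : nat) : nat :=
  Num.truncn (phase_density k * (2 * k).+1%:R).

(* The k-th block [k ^ 2, k.+1 ^ 2) is block_ones k ones followed by zeros, so
   there are O(sqrt n) changes of letter before n. *)
Definition density_word (i : nat) : bool :=
  [exists k : 'I_i.+1, k ^ 2 <= i < k ^ 2 + block_ones k]%N.

Local Notation a := density_word.

Definition ones_count (n : nat) : nat := \sum_(i < n) a i.
Definition changes_count (n : nat) : nat := \sum_(i < n) (a i != a i.+1).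

Lemma sqrS k : (k.+1 ^ 2 = k ^ 2 + (2 * k).+1)%N.
Proof. by rewrite -!mulnn; lia. Qed.

Lemma phase_density_itv k : p <= phase_density k <= q.
Proof. by rewrite /phase_density; case: ifP => _; rewrite lexx pq. Qed.

Lemma block_ones_itv k :
  phase_density k * (2 * k).+1%:R - 1 <= (block_ones k)%:R <=
    phase_density k * (2 * k).+1%:R.
Proof.
have /andP[h1 h2] := phase_density_itv k.
have h : 0 <= phase_density k * (2 * k).+1%:R.
  by rewrite mulr_ge0//; exact: le_trans h1.
have /andP[h3 h4] := truncn_itv h.
by rewrite h3 andbT; move: h4; rewrite -/(block_ones k) -natr1; lra.
Qed.

Lemma block_ones_le k : (block_ones k <= (2 * k).+1)%N.
Proof.
have /andP[_ h] := block_ones_itv k; have /andP[_ h2] := phase_density_itv k.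
rewrite -(ler_nat R); apply: (le_trans h); rewrite ler_piMl//.
exact: le_trans q1.
Qed.

Lemma density_wordE k j :
  (j < (2 * k).+1)%N -> a (k ^ 2 + j)%N = (j < block_ones k)%N.
Proof.
move=> jk; apply/existsP/idP => [[[k' /= hk'] /andP[h1 h2]]|h].
  have hb := block_ones_le k'.
  (* A run of ones never leaves its block, so [k'] and [k] are both the integer square root of the
     position. *)
  suff E : k' = k by move: h2; rewrite E ltn_add2l.
  have : (k' ^ 2 < k.+1 ^ 2)%N by rewrite sqrS; lia.
  have : (k ^ 2 < k'.+1 ^ 2)%N by rewrite sqrS; lia.
  by rewrite !ltn_exp2r//; lia.
have kk : (k < (k ^ 2 + j).+1)%N by rewrite -mulnn; nia.
by exists (Ordinal kk); rewrite /= leq_addr ltn_add2l.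
Qed.

Lemma sum_ltn_ord (n h : nat) : (\sum_(i < n) (i < h))%N = minn n h.
Proof.
elim: n => [|n IH]; first by rewrite big_ord0 min0n.
by rewrite big_ord_recr /= IH; case: ltnP; lia.
Qed.

Lemma ones_count_sqS k :
  ones_count (k.+1 ^ 2) = (ones_count (k ^ 2) + block_ones k)%N.
Proof.
rewrite sqrS /ones_count big_split_ord /=; congr addn.
rewrite (eq_bigr (fun j : 'I_(2 * k).+1 => (j < block_ones k)%N : nat)); last first.
  by move=> j _; rewrite density_wordE.
by rewrite sum_ltn_ord; apply/minn_idPr/block_ones_le.
Qed.

(** A block has at most two changes: from its ones to its zeros, and at its border with the next
    block. *)
Lemma changes_count_sq k : (changes_count (k ^ 2) <= 2 * k)%N.
Proof.
elim: k => [|k IH]; first by rewrite /changes_count big_ord0.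
rewrite sqrS /changes_count big_split_ord big_ord_recr /=.
suff : (\sum_(i < 2 * k) (a (k ^ 2 + i) != a (k ^ 2 + i).+1) <= 1)%N.
  move=> h; apply: leq_trans (leq_add IH (leq_add h (leq_b1 _))) _.
  by rewrite mulnS addnC.
rewrite (eq_bigr (fun i : 'I_(2 * k) => (i.+1 == block_ones k) : nat)); last first.
  move=> i _; have ik := ltn_ord i; rewrite -addnS !density_wordE//; last by lia.
  by congr (nat_of_bool _); case: (ltnP i) => /=; case: (ltnP i.+1) => /=; lia.
case: (block_ones k) => [|h]; first by rewrite big1.
under eq_bigr do rewrite eqSS.
have [hk|hk] := ltnP h (2 * k); last first.
  by rewrite big1// => i _; have := ltn_ord i; case: eqP => //; lia.
rewrite (bigD1 (Ordinal hk))//= eqxx big1// => i.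
by rewrite -val_eqE /= => /negPf ->.
Qed.

Lemma leq_ones_count n n' : (n <= n')%N -> (ones_count n <= ones_count n')%N.
Proof. by move=> /subnKC <-; rewrite /ones_count big_split_ord /= leq_addr. Qed.

Lemma leq_changes_count n n' :
  (n <= n')%N -> (changes_count n <= changes_count n')%N.
Proof. by move=> /subnKC <-; rewrite /changes_count big_split_ord /= leq_addr. Qed.

Lemma changes_countD n m : (changes_count (n + m) <= changes_count n + m)%N.
Proof.
rewrite /changes_count big_split_ord /= leq_add2l.
rewrite -[leqRHS](card_ord m) -sum1_card; apply: leq_sum => i _.
exact: leq_b1.
Qed.

(** The block lengths [2 * j + 1] for [i <= j < k] sum to [k ^ 2 - i ^ 2], and truncation loses at
    most 1 in each of the [k - i] blocks. *)
Lemma ones_count_sq_ge k i : (i <= k)%N ->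
  forall c, (forall j, (i <= j < k)%N -> c <= phase_density j) ->
  c * (k%:R ^+ 2 - i%:R ^+ 2) - (k%:R - i%:R) <=
    (ones_count (k ^ 2))%:R - (ones_count (i ^ 2))%:R.
Proof.
move=> /subnKC <-; elim: (k - i)%N => [|d IH] c hc.
  by rewrite addn0 !subrr mulr0 subrr.
have {}IH := IH c (fun j (hj : (i <= j < i + d)%N) => hc j ltac:(lia)).
have hc' := hc (i + d)%N ltac:(lia).
have /andP[hb _] := block_ones_itv (i + d)%N.
rewrite addnS ones_count_sqS natrD.
have : c * (2 * (i + d)).+1%:R <= phase_density (i + d)%N * (2 * (i + d)).+1%:R.
  by rewrite ler_wpM2r.
move: IH hb; rewrite -!natr1 natrM; set t := (i + d)%:R; set u := i%:R.
by set b := phase_density _; nra.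
Qed.

Lemma ones_count_sq_le k i : (i <= k)%N ->
  forall c, (forall j, (i <= j < k)%N -> phase_density j <= c) ->
  (ones_count (k ^ 2))%:R - (ones_count (i ^ 2))%:R <=
   c * (k%:R ^+ 2 - i%:R ^+ 2).
Proof.
move=> /subnKC <-; elim: (k - i)%N => [|d IH] c hc.
  by rewrite addn0 !subrr mulr0.
have {}IH := IH c (fun j (hj : (i <= j < i + d)%N) => hc j ltac:(lia)).
have hc' := hc (i + d)%N ltac:(lia).
have /andP[_ hb] := block_ones_itv (i + d)%N.
rewrite addnS ones_count_sqS natrD.
have : phase_density (i + d)%N * (2 * (i + d)).+1%:R <= c * (2 * (i + d)).+1%:R.
  by rewrite ler_wpM2r.
move: IH hb; rewrite -!natr1 natrM; set t := (i + d)%:R; set u := i%:R.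
by set b := phase_density _; nra.
Qed.

(** Moving from [n] to a neighbouring square costs at most [2 * k + 1], and truncation at most [k]
    in the lower bound, hence the constants 3 and 2. *)
Lemma ones_count_itv k n : (k ^ 2 <= n < k.+1 ^ 2)%N ->
  p * n%:R - 3 * k.+1%:R <= (ones_count n)%:R <= q * n%:R + 2 * k.+1%:R.
Proof.
move=> /andP[kn nk].
have S0 : ones_count (0 ^ 2) = 0%N by rewrite /ones_count big_ord0.
have h1 : (ones_count (k ^ 2))%:R <= (ones_count n)%:R :> R.
  by rewrite ler_nat leq_ones_count.
have h2 : (ones_count n)%:R <= (ones_count (k.+1 ^ 2))%:R :> R.
  by rewrite ler_nat leq_ones_count// ltnW.
have := @ones_count_sq_ge k 0 (leq0n _) p (fun j _ => proj1 (andP (phase_density_itv j))).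
have := @ones_count_sq_le k.+1 0 (leq0n _) q (fun j _ => proj2 (andP (phase_density_itv j))).
rewrite S0 -[k.+1%:R]natr1.
have k1 : k%:R ^+ 2 <= n%:R :> R by rewrite -natrX ler_nat.
have k2 : n%:R <= (k%:R + 1) ^+ 2 :> R by rewrite natr1 -natrX ler_nat ltnW.
have k0 : 0 <= k%:R :> R by [].
have [p1 q0 q1'] : [/\ p <= 1, 0 <= q & q <= 1] by split; move: p0 pq q1; lra.
rewrite expr0n /= !subr0 => h3 h4.
have e1 : p * n%:R <= p * (k%:R + 1) ^+ 2 by rewrite ler_wpM2l.
have e2 : q * k%:R ^+ 2 <= q * n%:R by rewrite ler_wpM2l.
have e3 : p * k%:R <= k%:R by rewrite ler_piMl.
have e4 : q * k%:R <= k%:R by rewrite ler_piMl.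
by apply/andP; split; lra.
Qed.

Lemma phase_densityE r j : (2 ^ 2 ^ r <= j < 2 ^ 2 ^ r.+1)%N ->
  phase_density j = if odd r then q else p.
Proof.
move=> /andP[h1 h2]; rewrite /phase_density.
suff -> : trunc_log 2 (trunc_log 2 j) = r by [].
have j0 : (0 < j)%N by apply: leq_trans h1; rewrite expn_gt0.
apply: trunc_log_eq => //; apply/andP; split.
  exact: trunc_log_max.
rewrite -(ltn_exp2l (m := 2))//; apply: leq_ltn_trans h2.
exact: trunc_logP.
Qed.

(** A phase that starts at block [i] ends at block [k = i ^ 2]. What precedes it fills only
    [i ^ 2 = k] positions, against [k ^ 2] at its end: an error of order [k]. *)
Lemma phase_end r : [/\ (r <= 2 ^ 2 ^ r.+1)%N, (2 ^ 2 ^ r <= 2 ^ 2 ^ r.+1)%N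
  & ((2 ^ 2 ^ r) ^ 2 = 2 ^ 2 ^ r.+1)%N].
Proof.
split.
- apply: ltnW; apply: (ltn_trans (ltnSn r)).
  by apply: (@ltn_trans (2 ^ r.+1)); rewrite ltn_expl.
- by rewrite !leq_exp2l.
- by rewrite -expnM expnS mulnC.
Qed.

Lemma ones_count_sq_frequently_ge (N : nat) : exists2 k, (N <= k)%N &
  q * (k ^ 2)%:R - 2 * k.+1%:R <= (ones_count (k ^ 2))%:R.
Proof.
have [rk ik ikE] := phase_end (2 * N).+1.
set r := (2 * N).+1 in rk ik ikE; set k := (2 ^ 2 ^ r.+1)%N in rk ik ikE.
exists k; first by rewrite /r in rk; lia.
have := @ones_count_sq_ge _ _ ik q.
have phi j : (2 ^ 2 ^ r <= j < k)%N -> q <= phase_density j.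
  by move=> /phase_densityE ->; rewrite /r /= mul2n odd_double.
move=> /(_ phi); rewrite -!natrX ikE -[k.+1%:R]natr1.
have : 0 <= (ones_count k)%:R :> R by [].
have : 0 <= (2 ^ 2 ^ r)%:R :> R by [].
have : q * k%:R <= k%:R by rewrite ler_piMl.
have : 0 <= k%:R :> R by [].
by lra.
Qed.

Lemma ones_count_sq_frequently_le (N : nat) : exists2 k, (N <= k)%N &
  (ones_count (k ^ 2))%:R <= p * (k ^ 2)%:R + 2 * k.+1%:R.
Proof.
have [rk ik ikE] := phase_end (2 * N).
set r := (2 * N)%N in rk ik ikE; set k := (2 ^ 2 ^ r.+1)%N in rk ik ikE.
exists k; first by rewrite /r in rk; lia.
have := @ones_count_sq_le _ _ ik p.
have phi j : (2 ^ 2 ^ r <= j < k)%N -> phase_density j <= p.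
  by move=> /phase_densityE ->; rewrite /r mul2n odd_double.
move=> /(_ phi); rewrite -!natrX ikE -[k.+1%:R]natr1.
have : (ones_count k)%:R <= k%:R :> R.
  rewrite ler_nat /ones_count -[leqRHS](card_ord k) -sum1_card.
  by apply: leq_sum => i _; exact: leq_b1.
have : 0 <= p * k%:R by rewrite mulr_ge0.
have : 0 <= k%:R :> R by [].
by lra.
Qed.

Lemma density_word_change i r :
  a i != a (i + r)%N -> (0 < \sum_(s < r) (a (i + s) != a (i + s).+1))%N.
Proof.
elim: r => [|r IH]; first by rewrite addn0 eqxx.
rewrite big_ord_recr /= addnS => h.
have [E|/IH] := eqVneq (a i) (a (i + r)%N); last exact: ltn_addr.
by rewrite -E h addn1.
Qed.

Lemma sum_changes_le n m :
  (\sum_(i < n) \sum_(s < m) (a (i + s) != a (i + s).+1) <=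
     m * changes_count (n + m))%N.
Proof.
rewrite exchange_big /= -[X in (_ <= X * _)%N](card_ord m) -sum_nat_const.
apply: leq_sum => s _; apply: (@leq_trans (changes_count (s + n))).
  rewrite /changes_count big_split_ord /=; apply: leq_trans (leq_addl _ _).
  by apply: leq_sum => i _; rewrite addnC.
by apply: leq_changes_count; rewrite addnC leq_add2l ltnW.
Qed.

Lemma changes_count_le k n m : (n < k.+1 ^ 2)%N ->
  (changes_count (n + m) <= 2 * k.+1 + m)%N.
Proof.
move=> nk; apply: (leq_trans (changes_countD _ _)); rewrite leq_add2r.
by apply: leq_trans (changes_count_sq k.+1); apply: leq_changes_count; exact: ltnW.
Qed.

End prescribed_density.

(** * From the word to a pair of sequences *)

Section word_frequency.
Context {R : realType} {K : nat}.
Hypothesis K_gt1 : (1 < K)%N.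
Local Notation X := (shift_space R K).
Variables (p q : R) (M : nat) (x y : X).
Hypotheses (p0 : 0 <= p) (pq : p <= q) (q1 : q <= 1) (M0 : (0 < M)%N).
Local Notation a := (density_word p q).
Hypothesis xy_eq : forall i, a i -> x i = y i.
Hypothesis xy_neq : forall i, ~~ a i -> (M %| i)%N -> x i != y i.

Let close eps i :=
  mdist (iter i (@shift_map R K) x) (iter i (@shift_map R K) y) < eps.

Let changes i m : nat := \sum_(s < m) (a (i + s)%N != a (i + s).+1).

Let leq_changes i m m' : (m <= m')%N -> (changes i m <= changes i m')%N.
Proof. by move=> /subnKC <-; rewrite /changes big_split_ord /= leq_addr. Qed.

Lemma close_le_word eps i : eps <= K%:R ^- M ->
  (close eps i <= a i + changes i M)%N.
Proof.
move=> epsM; case: (boolP (close eps i)) => // /ltW /le_trans /(_ epsM).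
move=> /(close_iterP K_gt1) xyi; case: (boolP (a i)) => // nai.
(* [i + r] is the first multiple of [M] from [i] on. There [x] and [y] agree, so the word must be 1,
   and it has changed since [i]. *)
pose r := ((M - i %% M) %% M)%N.
have rM : (r < M)%N by rewrite ltn_mod.
have Mir : (M %| i + r)%N.
  rewrite /dvdn /r modnDmr addnBA; last by rewrite ltnW// ltn_mod.
  by rewrite {1}(divn_eq i M) addnAC addnK modnDr modnMl.
have air : a (i + r)%N.
  by apply: contraT => /xy_neq /(_ Mir); rewrite xyi// eqxx.
rewrite add0n; apply: leq_trans (leq_changes i (ltnW rM)).
by apply: density_word_change; rewrite (negPf nai) air.
Qed.

Lemma word_le_close eps i m : K%:R ^- m < eps ->
  (a i <= close eps i + changes i m)%N.
Proof.
move=> epsm; case: (boolP (a i)) => // ai.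
case: (boolP (close eps i)) => // nclose.
case: (pickP (fun r : 'I_m => ~~ a (i + r)%N)) => [r nair|h].
  rewrite add0n; apply: leq_trans (leq_changes i (ltnW (ltn_ord r))).
  by apply: density_word_change; rewrite ai (negPf nair).
exfalso; move/negP: nclose; apply; apply: le_lt_trans epsm.
apply/(close_iterP K_gt1) => r rm; apply: xy_eq.
by have /= /negbFE := h (Ordinal rm).
Qed.

(** Closeness at [i] and the letter [a i] can differ only when the word changes soon after [i],
    which happens for O(sqrt n) indices below [n]. Hence all scales up to [K ^- M] share the
    frequencies of the word. *)
Lemma density_word_D_interval : D_interval (@shift_map R K) p q (x, y).
Proof.
have KV0 : 0 < K%:R ^- M :> R by rewrite invr_gt0 exprn_gt0// ltr0n; lia.
rewrite /D_interval /=; exists (K%:R ^- M) => // eps /andP[eps0 epsM] /=.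
have [m epsm] := exprVn_lt K_gt1 eps0.
pose C n := #|[pred i : 'I_n | close eps i]|.
have CE n : C n = (\sum_(i < n) close eps i)%N.
  by rewrite /C -sum1_card big_mkcond; apply: eq_bigr => i _; rewrite inE; case: close.
pose m' := (M + m)%N.
have sum_changes k n : (n < k.+1 ^ 2)%N ->
    (\sum_(i < n) changes i m' <= m' * (2 * k.+1 + m'))%N.
  move=> nk; apply: (leq_trans (@sum_changes_le _ _ _ _ _)).
  by rewrite leq_mul2l changes_count_le// orbT.
have Cle k n : (n < k.+1 ^ 2)%N ->
    (C n <= ones_count p q n + m' * (2 * k.+1 + m'))%N.
  move=> nk; apply: leq_trans (leq_add (leqnn _) (sum_changes _ _ nk)).
  rewrite CE /ones_count -big_split /=; apply: leq_sum => i _.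
  apply: (leq_trans (close_le_word i epsM)); rewrite leq_add2l leq_changes//.
  exact: leq_addr.
have Cge k n : (n < k.+1 ^ 2)%N ->
    (ones_count p q n <= C n + m' * (2 * k.+1 + m'))%N.
  move=> nk; apply: leq_trans (leq_add (leqnn _) (sum_changes _ _ nk)).
  rewrite CE /ones_count -big_split /=; apply: leq_sum => i _.
  apply: (leq_trans (word_le_close i epsm)); rewrite leq_add2l leq_changes//.
  exact: leq_addl.
(* The 3 absorbs the error of [ones_count_itv], the rest the changes: [m' * (2 * k.+1 + m') <= m' *
   (2 + m') * k.+1]. *)
pose D : R := (3 + m' * (2 + m'))%:R.
have err k : 3 * k.+1%:R + (m' * (2 * k.+1 + m'))%:R <= D * k.+1%:R.
  rewrite /D -!natrM -natrD ler_nat.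
  by rewrite !mulnDl !mulnDr; nia.
have CleR k n : (n < k.+1 ^ 2)%N ->
    (C n)%:R <= (ones_count p q n)%:R + (m' * (2 * k.+1 + m'))%:R :> R.
  by move=> nk; rewrite -natrD ler_nat Cle.
have CgeR k n : (n < k.+1 ^ 2)%N ->
    (ones_count p q n)%:R <= (C n)%:R + (m' * (2 * k.+1 + m'))%:R :> R.
  by move=> nk; rewrite -natrD ler_nat Cge.
have sqlt k : (k ^ 2 < k.+1 ^ 2)%N by rewrite ltn_exp2r.
apply: (@limn_freq_sqrt_error _ C p q D) => //.
- move=> k n kn; have /andP[_ nk] := kn.
  have /andP[] := ones_count_itv p0 pq q1 kn.
  have := CleR _ _ nk; have := CgeR _ _ nk; have := err k.
  have : 0 <= k.+1%:R :> R by [].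
  by move=> *; apply/andP; split; lra.
- move=> N; have [k Nk] := ones_count_sq_frequently_ge p0 pq q1 N.
  exists k => //; have := CgeR _ _ (sqlt k); have := err k.
  have : 0 <= k.+1%:R :> R by [].
  by lra.
- move=> N; have [k Nk] := ones_count_sq_frequently_le p0 pq q1 N.
  exists k => //; have := CleR _ _ (sqlt k); have := err k.
  have : 0 <= k.+1%:R :> R by [].
  by lra.
Qed.

End word_frequency.

(** * Lower bound *)

Section mass_distribution.
Context {R : realType} {K : nat}.
Hypothesis K_gt1 : (1 < K)%N.
Local Notation X := (shift_space R K).

Let Kge1 : 1 <= K%:R :> R. Proof. by rewrite ler1n ltnW. Qed.
Let Kgt0 : 0 < K%:R :> R. Proof. exact: lt_le_trans Kge1. Qed.

Lemma truncn_exp_itv n (t : R) : 0 <= t ->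
  (Num.truncn (K%:R ^+ n * t))%:R / K%:R ^+ n <= t <
    (Num.truncn (K%:R ^+ n * t)).+1%:R / K%:R ^+ n.
Proof.
move=> t0; have Kn0 : 0 < K%:R ^+ n :> R by rewrite exprn_gt0.
have /truncn_itv/andP[h1 h2] : 0 <= K%:R ^+ n * t by rewrite mulr_ge0// ltW.
by rewrite ler_pdivrMr// ltr_pdivlMr// [t * _]mulrC h1 h2.
Qed.

Variables (A : set (X * X)) (psi : R -> X * X) (slot : nat -> nat).
Hypothesis psiA : forall t, 0 <= t < 1 -> A (psi t).
Hypothesis psi_prefix : forall n t u, 0 <= t < 1 -> 0 <= u < 1 ->
  (forall i, (i < n)%N -> (psi t).1 i = (psi u).1 i /\ (psi t).2 i = (psi u).2 i) ->
  Num.truncn (K%:R ^+ slot n * t) = Num.truncn (K%:R ^+ slot n * u).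
Hypothesis slot_ge : forall n, (n <= slot n)%N.

(** With [n] the first coordinate where two points of [U] differ, the whole preimage of [U] shares
    [slot n] digits and lies in one K-adic interval, measurable whatever [U] is. Moreover [diam U]
    is at least [K ^- n.+1], whence [n.+1] in the hypothesis. *)
Lemma preimage_cover_itv (s : R) (n0 : nat) (U : set (X * X)) : 0 <= s ->
  (forall n, (n0 <= n)%N -> s * n.+1%:R <= (slot n)%:R) ->
  (diam U <= (K%:R ^- n0)%:E)%E ->
  exists I : set R, [/\ measurable I,
    forall t, 0 <= t < 1 -> U (psi t) -> I t &
    (lebesgue_measure I <= diam_pow s U)%E].
Proof.
move=> s0 slots dU.
case: (pselect (exists2 t, 0 <= t < 1 & U (psi t))) => [[u u01 Uu]|none]; last first.
  exists set0; split; [exact: measurable0| |by rewrite measure0 diam_pow_ge0].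
  by move=> t t01 Ut; exfalso; apply: none; exists t.
have /andP[u0 u1] := u01.
pose P n := `[< exists z w, [/\ U z, U w & ~ (z.1 n = w.1 n /\ z.2 n = w.2 n)] >].
case: (pselect (exists n, P n)) => [exP|noP].
  case: (ex_minnP exP) => n /asboolP[z [w [Uz Uw zw]]] minn.
  have agree z' w' i : U z' -> U w' -> (i < n)%N ->
      z'.1 i = w'.1 i /\ z'.2 i = w'.2 i.
    move=> Uz' Uw' ilt; apply: contrapT => h.
    have : P i by apply/asboolP; exists z', w'.
    by move/minn; rewrite leqNgt ilt.
  have n0n : (n0 <= n)%N.
    rewrite leqNgt; apply/negP => nn0; apply: zw.
    have := le_trans (mdist_le_diam Uz Uw) dU; rewrite lee_fin.
    by move/(shift_mdist2_le K_gt1); apply.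
  set j := Num.truncn (K%:R ^+ slot n * u).
  exists `[j%:R / K%:R ^+ slot n, j.+1%:R / K%:R ^+ slot n[%classic; split.
  - exact: measurable_itv.
  - move=> t t01 Ut /=; rewrite in_itv /= /j.
    rewrite -(psi_prefix t01 u01 (fun i ilt => agree _ _ i Ut Uu ilt)).
    by apply: truncn_exp_itv; case/andP: t01.
  - rewrite lebesgue_measure_itv /= lte_fin.
    have Kf : 0 < (K%:R ^+ slot n)^-1 :> R by rewrite invr_gt0 exprn_gt0.
    rewrite ltr_pM2r// ltr_nat ltnSn -EFinB -mulrBl -natrB// subSnn mul1r.
    rewrite /diam_pow; case: eqP => [U0|_]; first by move: Uu; rewrite U0.
    apply: (@le_trans _ _ (((K%:R ^- n.+1) `^ s)%:E)); last first.
      rewrite -poweR_EFin gt0_ler_poweR ?in_itv/= ?leey ?andbT ?diam_ge0 ?lee_fin//.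
      apply: le_trans (mdist_le_diam Uz Uw); rewrite lee_fin ltW// ltNge.
      by apply/negP => /(shift_mdist2_le K_gt1) h; apply: zw; exact: h.
    rewrite lee_fin -powR_mulrn ?(ltW Kgt0)// -powRN.
    rewrite -(powR_mulrn n.+1) ?(ltW Kgt0)// -powRN -powRrM ler_powR//.
    by have := slots _ n0n; lra.
(* No two points of [U] differ: all digits are fixed, as [slot] is unbounded, so the preimage is a
   single point. *)
exists [set u]; split; [exact: measurable_set1| |]; last first.
  by rewrite lebesgue_measure_set1 diam_pow_ge0.
move=> t t01 Ut /=; have /andP[t0 t1] := t01.
have same n : Num.truncn (K%:R ^+ slot n * t) = Num.truncn (K%:R ^+ slot n * u).
  apply: psi_prefix => // i _; apply: contrapT => h; apply: noP; exists i.
  by apply/asboolP; exists (psi t), (psi u).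
apply/eqP; rewrite -subr_eq0 -normr_le0 leNgt; apply/negP => tu0.
have [n hn] := exprVn_lt K_gt1 tu0.
have /andP[t2 t3] := truncn_exp_itv (slot n) t0.
have /andP[u2 u3] := truncn_exp_itv (slot n) u0.
move: t2 t3; rewrite same => t2 t3.
have : `|t - u| < K%:R ^- slot n.
  move: t3 u3; rewrite -natr1 mulrDl mul1r ltr_norml => *.
  by apply/andP; split; lra.
apply/negP; rewrite -leNgt; apply: le_trans (ltW hn).
by rewrite lef_pV2 ?posrE ?exprn_gt0// ler_weXn2l.
Qed.

Lemma hausdorff_measure_ge1 (s : R) (n0 : nat) : 0 <= s ->
  (forall n, (n0 <= n)%N -> s * n.+1%:R <= (slot n)%:R) ->
  (1 <= hausdorff_measure s A)%E.
Proof.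
move=> s0 slots.
have Kn0 : 0 < K%:R ^- n0 :> R by rewrite invr_gt0 exprn_gt0.
apply: (@le_trans _ _ (hausdorff_premeasure s (K%:R ^- n0) A)); last first.
  by apply: ereal_sup_ubound; exists (K%:R ^- n0).
apply: le_ereal_inf_tmp => _ [U [AU dU] <-].
have /choice[I hI] := fun i => preimage_cover_itv s0 slots (dU i).
have <- : lebesgue_measure (`[0, 1[%classic : set R) = 1%E.
  by rewrite lebesgue_measure_itv /= lte_fin ltr01 -EFinB subr0.
apply: (@le_trans _ _ (\sum_(0 <= i <oo) lebesgue_measure (I i))%E).
  apply: measure_sigma_subadditive.
  - by move=> i; have [] := hI i.
  - exact: measurable_itv.
  - move=> t /=; rewrite in_itv /= => t01.
    by have [i _ Ui] := AU _ (psiA t01); exists i => //; have [_ + _] := hI i; apply.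
by apply: lee_nneseries => [i _ _|i _]; [exact: measure_ge0|have [] := hI i].
Qed.

End mass_distribution.

(** * Feeding digits into the free coordinates *)

Section slots.
Variables (a : nat -> bool) (M : nat).

Definition free (i : nat) : bool := ~~ a i && ~~ (M %| i)%N.

(* slot n is the number of coordinates of index < n, in x and y together, that
   carry a digit. *)
Definition slot (n : nat) : nat := \sum_(i < n) (1 + free i).

Lemma slotS n : slot n.+1 = (slot n + (1 + free n))%N.
Proof. by rewrite /slot big_ord_recr. Qed.

Lemma leq_slot n : (n <= slot n)%N.
Proof. by elim: n => // n IH; rewrite slotS; lia. Qed.

Lemma sum_dvdn n : (0 < M)%N -> (\sum_(i < n.+1) (M %| i) = 1 + n %/ M)%N.
Proof.
move=> M0; elim: n => [|n IH]; first by rewrite big_ord_recr big_ord0 /= dvdn0 div0n.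
by rewrite big_ord_recr /= IH divnS//; lia.
Qed.

(** Each of the [2 * n] coordinates carries a digit, except those of [y] at ones of [a] or at
    multiples of [M]; [1 + n %/ M] counts the multiples up to [n] included. *)
Lemma slot_lower n : (0 < M)%N ->
  (2 * n <= slot n + \sum_(i < n) a i + (1 + n %/ M))%N.
Proof.
move=> M0; rewrite -sum_dvdn//.
apply: (@leq_trans (slot n + \sum_(i < n) a i + \sum_(i < n) (M %| i))); last first.
  by rewrite leq_add2l big_ord_recr /= leq_addr.
rewrite /slot -!big_split /= mulnC -[X in (X * _)%N](card_ord n) -sum_nat_const.
by apply: leq_sum => i _; rewrite /free; case: (a i); case: (_ %| _)%N.
Qed.

End slots.

Section digit_coding.
Context {R : realType} {K : nat}.
Hypothesis K_gt1 : (1 < K)%N.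
Local Notation X := (shift_space R K).

Let K_gt0 : (0 < K)%N. Proof. exact: ltnW. Qed.

Definition digit (n : nat) (t : R) : 'I_K :=
  Ordinal (ltn_pmod (Num.truncn (K%:R ^+ n.+1 * t)) K_gt0).

Definition next_letter (c : 'I_K) : 'I_K := Ordinal (ltn_pmod c.+1 K_gt0).

Lemma next_letter_neq c : next_letter c != c.
Proof.
rewrite -val_eqE /=; have := ltn_ord c; rewrite leq_eqVlt => /orP[/eqP E|cK].
  by rewrite E modnn; apply/eqP => c0; move: E; rewrite -c0; lia.
by rewrite modn_small//; apply/eqP; lia.
Qed.

Lemma truncn_expS_div n (t : R) : 0 <= t ->
  (Num.truncn (K%:R ^+ n.+1 * t) %/ K)%N = Num.truncn (K%:R ^+ n * t).
Proof.
move=> t0; have h0 : 0 <= K%:R ^+ n * t by rewrite mulr_ge0// exprn_ge0.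
have h1 : 0 <= K%:R ^+ n.+1 * t by rewrite mulr_ge0// exprn_ge0.
have K0 : 0 < K%:R :> R by rewrite ltr0n.
have /andP[a1 a2] := truncn_itv h0.
apply/eqP; rewrite eqn_leq -ltnS ltn_divLR// leq_divRL//.
rewrite truncn_lt_nat// truncn_ge_nat// exprS -mulrA !natrM ![_ * K%:R]mulrC.
by rewrite ltr_pM2l// ler_pM2l// a2 a1.
Qed.

Lemma digit_prefix N (t u : R) : 0 <= t < 1 -> 0 <= u < 1 ->
  (forall j, (j < N)%N -> digit j t = digit j u) ->
  Num.truncn (K%:R ^+ N * t) = Num.truncn (K%:R ^+ N * u).
Proof.
move=> t01 u01; elim: N => [|N IH] h.
  by rewrite !expr0 !mul1r !(@truncn_def _ _ 0).
have /andP[t0 _] := t01; have /andP[u0 _] := u01.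
rewrite (divn_eq (Num.truncn (_ * t)) K) (divn_eq (Num.truncn (_ * u)) K).
rewrite !truncn_expS_div// IH; last by move=> j jN; apply: h; exact: leqW.
by congr addn; have /(congr1 val) := h N (ltnSn N).
Qed.

Variables (a : nat -> bool) (M : nat).

Local Notation slot := (slot a M).

(** [x] takes the fresh digit number [slot i]; [y] repeats it, takes a different letter, or takes
    the next fresh digit. No digit is skipped, so a prefix of the pair determines a prefix of the
    digits. *)
Definition code (t : R) : X * X :=
  (fun i => digit (slot i) t,
   fun i => if a i then digit (slot i) t
            else if (M %| i)%N then next_letter (digit (slot i) t)
            else digit (slot i).+1 t).

Lemma code_digits n t u :
  (forall i, (i < n)%N ->
    (code t).1 i = (code u).1 i /\ (code t).2 i = (code u).2 i) ->
  forall j, (j < slot n)%N -> digit j t = digit j u.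
Proof.
elim: n => [|n IH] h j; first by rewrite /slot big_ord0.
have {}IH := IH (fun i hi => h i (leqW hi)).
have [jn _|nj] := ltnP j (slot n); first exact: IH.
have [/= h1 h2] := h n (ltnSn n).
rewrite slotS => jn; have [->//|jneq] := eqVneq j (slot n).
move: h2 jn; rewrite /free; case: (a n) => /=; first by lia.
case: (M %| n)%N => /=; first by lia.
by move=> h2 jn; have -> : j = (slot n).+1 by lia.
Qed.

Lemma code_prefix n t u : 0 <= t < 1 -> 0 <= u < 1 ->
  (forall i, (i < n)%N ->
    (code t).1 i = (code u).1 i /\ (code t).2 i = (code u).2 i) ->
  Num.truncn (K%:R ^+ slot n * t) = Num.truncn (K%:R ^+ slot n * u).
Proof. by move=> t01 u01 /code_digits; exact: digit_prefix. Qed.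

End digit_coding.

Section lower_bound_dim.
Context {R : realType} {K : nat}.
Hypothesis K_gt1 : (1 < K)%N.

Lemma slot_density_word_ge (p q e s : R) (M : nat) :
  0 <= p -> p <= q -> q <= 1 -> 0 < e -> M%:R^-1 <= e / 2 -> (0 < M)%N ->
  s < 2 - q - e ->
  exists n0, forall n, (n0 <= n)%N ->
    s * n.+1%:R <= (slot (density_word p q) M n)%:R.
Proof.
move=> p0 pq q1 e0 Me M0 se; pose k0 := (Num.truncn (14 / e)).+1.
exists (k0 ^ 2)%N => n k0n; have [k kn] := sqrt_interval n.
have /andP[k2n nk2] := kn.
have k0k : (k0 <= k)%N by have := leq_ltn_trans k0n nk2; rewrite ltn_exp2r.
have k1 : 1 <= k%:R :> R by rewrite ler1n; apply: leq_trans k0k.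
have ek : 14 <= e * k%:R.
  rewrite [leRHS]mulrC -ler_pdivrMr//; apply: (le_trans (ltW (truncnS_gt _))).
  by rewrite ler_nat.
have kn' : k%:R * k%:R <= n%:R :> R by rewrite -natrM ler_nat.
have ekk : 14 * k%:R <= e * k%:R * k%:R by rewrite ler_wpM2r.
have en : e * k%:R * k%:R <= e * n%:R by rewrite -mulrA ler_wpM2l// ltW.
have /andP[_ ones] := ones_count_itv p0 pq q1 kn.
have nM : (n %/ M)%:R <= e / 2 * n%:R.
  apply: (@le_trans _ _ (M%:R^-1 * n%:R)); last by rewrite ler_wpM2r.
  by rewrite mulrC ler_pdivlMr ?ltr0n// -natrM ler_nat leq_trunc_div.
have : (2 * n)%:R <= (slot (density_word p q) M n)%:R + (ones_count p q n)%:R +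
    (1 + (n %/ M)%:R) :> R.
  by rewrite -natrD -[1]/(1%:R) -!natrD ler_nat slot_lower.
have sn : s * n.+1%:R <= (2 - q - e) * n.+1%:R by rewrite ler_wpM2r// ltW.
move: sn ones; rewrite -[n.+1%:R]natr1 -[k.+1%:R]natr1 natrM => sn ones.
have q0 : 0 <= q by lra.
by lra.
Qed.

(** For [s < 2 - q - e] the measure is at least 1, so [s] is not an exponent of measure 0. The
    forced disagreements at multiples of [M] cost at most [1 / M <= e / 2]. *)
Lemma hausdorff_dim_D_interval_ge (p q : R) : 0 <= p -> p <= q -> q <= 1 ->
  ((2 - q)%:E <= hausdorff_dim (D_interval (@shift_map R K) p q))%E.
Proof.
move=> p0 pq q1; apply/lee_subgt0Pr => e e0; rewrite -EFinB.
apply: le_ereal_inf_tmp => _ [s [s0 Hs0] <-]; rewrite lee_fin leNgt.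
apply/negP => se; pose M := (Num.truncn (2 / e)).+1.
have Me : M%:R^-1 <= e / 2.
  by rewrite -[leRHS]invrK lef_pV2 ?posrE ?ltr0n ?invr_gt0 ?divr_gt0// invf_div ltW// truncnS_gt.
have [n0 hn0] := slot_density_word_ge p0 pq q1 e0 Me (ltn0Sn _) se.
have : (1 <= hausdorff_measure s (D_interval (@shift_map R K) p q))%E.
  apply: (@hausdorff_measure_ge1 _ _ K_gt1 _
    (code K_gt1 (density_word p q) M) (slot (density_word p q) M) _ _ _ s n0) => //.
  - move=> t t01; apply: (density_word_D_interval K_gt1 (M := M)) => // i /=.
      by move=> ->.
    by move=> /negPf -> ->; rewrite eq_sym next_letter_neq.
  - exact: code_prefix.
  - exact: leq_slot.
by rewrite Hs0 lee_fin ler10.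
Qed.

End lower_bound_dim.

(** * Combining the bounds *)

Lemma D_family_subset_E_family (R : realType) (X : metricType R) (f : X -> X)
    (J : set (set R)) : D_family f J `<=` E_family f J.
Proof.
move=> z [p [q [pq Jpq [eps0 e0 hD]]]]; exists p, q; split => //.
have near_eps : \forall eps \near 0^'+, 0 < eps <= eps0.
  near=> eps; apply/andP; split; first by near: eps; exact: nbhs_right_gt.
  by near: eps; exact: nbhs_right_le.
by split; apply: cvg_near_cst; apply: filterS near_eps => eps /hD[].
Unshelve. all: by end_near. Qed.

Theorem theorem6p10 (R : realType) (K : nat) (K_ge2 : (2 <= K)%N)
    (J : set (set R)) (J_neq0 : J !=set0)
    (J_itv : forall I, J I -> compact_subinterval01 I) :
  hausdorff_dim (E_family (@shift_map R K) J) =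
    hausdorff_dim (D_family (@shift_map R K) J) /\
  hausdorff_dim (D_family (@shift_map R K) J) =
    (2 - inf [set sup I | I in J])%:E.
Proof.
set S := [set sup I | I in J]; set q0 := inf S.
have supJ I : J I -> exists p q,
    [/\ 0 <= p, p <= q, q <= 1, I = `[p, q]%classic & sup I = q].
  by move=> /J_itv[p [q [p0 pq q1 ->]]]; exists p, q; rewrite sup_itvcc.
have S_inf : has_inf S.
  split; first by have [I JI] := J_neq0; exists (sup I), I.
  by exists 0 => _ [I /supJ[p [q [p0 pq q1 _ ->]]] <-]; exact: le_trans pq.
have q0_le p q : p <= q -> J `[p, q]%classic -> q0 <= q.
  move=> pq Jpq; apply: ge_inf; first by case: S_inf.
  by exists `[p, q]%classic => //; rewrite sup_itvcc.
have q01 : q0 <= 1.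
  have [I JI] := J_neq0; have [p [q [p0 pq q1 E _]]] := supJ _ JI.
  by apply: le_trans q1; apply: (q0_le p) => //; rewrite -E.
have le_DE : (hausdorff_dim (D_family (@shift_map R K) J) <=
    hausdorff_dim (E_family (@shift_map R K) J))%E.
  exact/le_hausdorff_dim/D_family_subset_E_family.
have le_E : (hausdorff_dim (E_family (@shift_map R K) J) <= (2 - q0)%:E)%E.
  exact: hausdorff_dim_E_family_le.
have le_D : ((2 - q0)%:E <= hausdorff_dim (D_family (@shift_map R K) J))%E.
  apply/lee_subgt0Pr => e e0; rewrite -EFinB.
  (* The infimum need not be attained: some interval of [J] has supremum below [q0 + e], and its
     [D_interval] alone gives the bound up to [e]. *)
  have [_ [I JI <-] Iq0] := inf_adherent e0 S_inf.
  have [p [q [p0 pq q1 IE supI]]] := supJ _ JI; rewrite supI in Iq0.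
  apply: (@le_trans _ _ (2 - q)%:E); first by rewrite lee_fin; move: Iq0; rewrite -/q0; lra.
  apply: le_trans (hausdorff_dim_D_interval_ge K_ge2 p0 pq q1) _.
  by apply: le_hausdorff_dim => z Dz; exists p, q; split => //; rewrite -IE.
have DE : hausdorff_dim (D_family (@shift_map R K) J) = (2 - q0)%:E.
  by apply/eqP; rewrite eq_le le_D andbT (le_trans le_DE).
by split => //; apply/eqP; rewrite eq_le le_DE DE le_E.
Qed.
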